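(* Let $(V,\langle\,,\rangle)$ be a Lorentzian vector space of dimension $n\geq 3$ and $K$ a curvature tensor on $V$ whose Ricci operator satisfies $K(u,v)\circ\mathrm{Ric}=\mathrm{Ric}\circ K(u,v)$ for all $u,v\in V$. Then $\mathrm{Ric}$ is either of type $\{\mathrm{diag}\}$ or of type $\{n,02\}$. In particular, all its eigenvalues are real.
   Context: A Lorentzian vector space is a finite-dimensional real vector space with a nondegenerate inner product of signature $(1,n-1)$ (one minus sign); $\mathrm{so}(V)$ is the Lie algebra of its skew-symmetric endomorphisms. A curvature tensor on $V$ is a bilinear map $K:V\times V\to\mathrm{so}(V)$ with $K(u,v)=-K(v,u)$ and $K(u,v)w+K(v,w)u+K(w,u)v=0$. Its Ricci curvature is $\mathrm{r}(u,v)=\mathrm{tr}(a\mapsto K(u,a)v)$ and its Ricci operator $\mathrm{Ric}$ is defined by $\langle\mathrm{Ric}(u),v\rangle=\mathrm{r}(u,v)$. A symmetric endomorphism $f$ of $V$ is of type $\{\mathrm{diag}\}$ if there is a basis $\mathbb{B}$ in which $f$ has matrix $\mathrm{diag}(\alpha_1,\dots,\alpha_n)$ and $\langle\,,\rangle$ has matrix $\mathrm{diag}(+1,\dots,+1,-1)$, with $\alpha_i\in\mathbb{R}$. It is of type $\{n,02\}$ if there is a basis in which $f$ has matrix $\mathrm{diag}(\alpha_1,\dots,\alpha_{n-2})\oplus\begin{pmatrix}0&1\\0&0\end{pmatrix}$ and $\langle\,,\rangle$ has matrix $I_{n-2}\oplus\begin{pmatrix}0&1\\1&0\end{pmatrix}$,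 with $\alpha_i\in\mathbb{R}$.
   Formalization: In type {n,02} the nilpotent block of Ric is taken as (0 ε; 0 0) with ε = 1 or −1 instead of only (0 1; 0 0), since replacing K by −K reverses the sign of Ric and the claim with ε = 1 alone is false. *)

(* Defs.v *)
From HB Require Import structures.
From mathcomp Require Import all_boot all_order all_algebra.
From mathcomp Require Import reals.
From mathcomp Require Import complex.

Set Implicit Arguments.
Unset Strict Implicit.
Unset Printing Implicit Defensive.

Import Order.TTheory GRing.Theory Num.Theory.
Local Open Scope ring_scope.

Section Endomorphisms.
Variables (R : realType) (V : vectType R).

(* Column convention: column j holds the coordinates of [f e_j]. *)
Definition endo_mx n (e : n.-tuple V) (f : 'End(V)) : 'M[R]_n :=
  \matrix_(i, j) coord e i (f (tnth e j)).

Definition endo_tr (f : 'End(V)) : R := \tr (endo_mx (vbasis fullv) f).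

(* Eigenvalues of the complexification of [f]. *)
Definition complex_eigenvalue (f : 'End(V)) (z : R[i]) : bool :=
  eigenvalue (map_mx (real_complex R) (endo_mx (vbasis fullv) f)) z.

End Endomorphisms.

Section InnerProduct.
Variables (R : realType) (V : vectType R) (g : {symmetric V}).

Definition gram_mx n (e : n.-tuple V) : 'M[R]_n :=
  \matrix_(i, j) g (tnth e i) (tnth e j).

(* Signature written (number of minus signs, number of plus signs). *)
Definition has_signature (q p : nat) : Prop :=
  exists (n : nat) (e : n.-tuple V),
    [/\ basis_of fullv e,
        forall i j : 'I_n, i != j -> g (tnth e i) (tnth e j) = 0,
        #|[set i : 'I_n | g (tnth e i) (tnth e i) < 0]| = q
      & #|[set i : 'I_n | 0 < g (tnth e i) (tnth e i)]| = p].

Definition lorentzian : Prop :=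
  nondegenerate g /\ has_signature 1 (\dim (fullv : {vspace V})).-1.

Definition symmetric_endo (f : 'End(V)) : Prop :=
  forall u v, g (f u) v = g u (f v).

Definition skew_endo (f : 'End(V)) : Prop :=
  forall u v, g (f u) v = - g u (f v).

Record curvature_tensor (K : {bilinear V -> V -> 'End(V)}) : Prop := {
  curvature_so : forall u v, skew_endo (K u v);
  curvature_anti : forall u v, K u v = - K v u;
  curvature_bianchi : forall u v w, K u v w + K v w u + K w u v = 0
}.

Definition ricci_curvature (K : {bilinear V -> V -> 'End(V)}) (u v : V) : R :=
  endo_tr (linfun (fun a => K u a v)).

Definition ricci_operator (K : {bilinear V -> V -> 'End(V)}) (Ric : 'End(V)) :
    Prop :=
  forall u v, g (Ric u) v = ricci_curvature K u v.

Definition type_diag (f : 'End(V)) : Prop :=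
  symmetric_endo f /\
  exists (m : nat) (e : (m + 1).-tuple V) (a : 'rV[R]_(m + 1)),
    [/\ basis_of fullv e,
        endo_mx e f = diag_mx a
      & gram_mx e = block_mx 1%:M 0 0 (- 1%:M)].

(* The lower right blocks are ((0, eps), (0, 0)), with eps = 1 or -1, and
   ((0, 1), (1, 0)). The sign eps cannot be normalized away: for a null basis
   vector x with [f x = eps *: y] and [g x y = 1] one has [g (f x) x = eps], and
   when all the a_i vanish eps is the sign of the semidefinite form
   [fun v => g (f v) v]. Both signs occur for Ricci operators, since [- K] is a
   curvature tensor whenever [K] is, with opposite Ricci operator. *)
Definition type_n02 (f : 'End(V)) : Prop :=
  symmetric_endo f /\
  exists (m : nat) (e : (m + 2).-tuple V) (a : 'rV[R]_m) (eps : R),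
    [/\ basis_of fullv e,
        eps = 1 \/ eps = - 1,
        endo_mx e f = block_mx (diag_mx a) 0 0 (eps *: delta_mx 0 1)
      & gram_mx e = block_mx 1%:M 0 0 (delta_mx 0 1 + delta_mx 1 0)].

End InnerProduct.

(* Main.v *)
(* Write A for the Ricci operator. The pair symmetry of K turns the commutation
   hypothesis into K(Au,v) = K(u,Av), hence also into K(p(A)u,v) = K(u,p(A)v)
   for every polynomial p, and K(Au,u) = 0; moreover Ax = 0 as soon as
   K(x,.) = 0. So an "exotic" vector x is disposed of by showing that no nonzero
   w is orthogonal to {v | K(x,v) = 0}.
   - If v is killed by q(A) = (A - a)^2 + b^2 with b <> 0, then that space
     contains v, Av and the image of q(A). The plane spanned by v and Av contains
     a timelike vector, so q(A) is injective on its orthogonal; hence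
     K(v,.) = 0 and Av = 0, a contradiction.
   - A timelike eigenvector has a positive definite invariant orthogonal, on
     which A is diagonalizable.
   - Let x be a null eigenvector and N = A - a. If ker N is not orthogonal to x,
     it contains a timelike vector. Otherwise x = Ny, and K(x,.) vanishes on
     im N + ker N, whose orthogonal is the line of x. Either <x,y> <> 0, so that
     K(x,.) = 0, a = 0, and A is nilpotent on the Lorentzian plane spanned by x
     and y; or x = N^2 z, and then both K(x,.) and K(Nz,.) vanish, which forces
     x = A(Nz) = 0.
   - One of these vectors exists: split off spacelike eigenvectors. *)
From HB Require Import structures.
Require Import Defs.
From mathcomp Require Import all_boot all_order all_algebra.
From mathcomp Require Import reals.
From mathcomp Require Import complex spectral.
From mathcomp Require Import ring lra.

Set Implicit Arguments.
Unset Strict Implicit.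
Unset Printing Implicit Defensive.

Import Order.TTheory GRing.Theory Num.Theory.
Local Open Scope ring_scope.

(** * Symmetric bilinear forms: representing linear forms, double orthogonals *)

Section Form.
Variables (R : realType) (V : vectType R) (g : {symmetric V}).
Implicit Types (f : 'End(V)) (u v w x y : V) (U W : {vspace V}) (a b c : R).

Lemma ipC u v : g u v = g v u.
Proof. by rewrite hermC expr0 mul1r. Qed.

Lemma ipDl u v w : g (u + v) w = g u w + g v w.
Proof. exact: linearDl. Qed.

Lemma ipDr u v w : g w (u + v) = g w u + g w v.
Proof. exact: linearDr. Qed.

Lemma ipNl u w : g (- u) w = - g u w.
Proof. exact: linearNl. Qed.

Lemma ipNr u w : g w (- u) = - g w u.
Proof. exact: linearNr. Qed.

Lemma ipZl a u w : g (a *: u) w = a * g u w.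
Proof. exact: linearZl_LR. Qed.

Lemma ipZr a u w : g w (a *: u) = a * g w u.
Proof. by rewrite ipC ipZl ipC. Qed.

Definition ipE := (ipDl, ipDr, ipNl, ipNr, ipZl, ipZr).

Lemma ip0l w : g 0 w = 0.
Proof. exact: linear0l. Qed.

Lemma ip0r w : g w 0 = 0.
Proof. exact: linear0r. Qed.

Lemma ip_sumr w (I : finType) (F : I -> V) :
  g w (\sum_i F i) = \sum_i g w (F i).
Proof. exact: linear_sumr. Qed.

Lemma nondegenerate_eq0 u : nondegenerate g -> (forall v, g u v = 0) -> u = 0.
Proof.
move=> /eqP rad0 gu0; apply/eqP; rewrite -memv0 -rad0.
by apply/mem_orthovP => v _.
Qed.

(** By nondegeneracy, pairing with a basis defines an injective, hence bijective, endomorphism [T]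
    of [V]. *)
Lemma form_representable (phi : {scalar V}) :
  nondegenerate g -> exists w, forall v, g w v = phi v.
Proof.
move=> gnd; pose e := vbasis {:V}.
pose T w : V := \sum_(i < \dim {:V}) g w e`_i *: e`_i.
have linT : linear T.
  move=> c u v; rewrite /T scaler_sumr -big_split; apply: eq_bigr => i _ /=.
  by rewrite !ipE scalerDl scalerA.
pose LT : {linear V -> V} := HB.pack T (GRing.isLinear.Build _ _ _ _ T linT).
have efree : free e := basis_free (vbasisP _).
have coordT w i : coord e i (T w) = g w e`_i by exact: coord_sum_free.
have ker0 : lker (linfun LT) == 0%VS.
  rewrite -subv0; apply/subvP => w; rewrite memv_ker lfunE memv0 /= => /eqP Tw0.
  apply/eqP/(nondegenerate_eq0 gnd) => v.
  rewrite (coord_vbasis (memvf v)) ip_sumr big1 // => i _.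
  by rewrite ipZr -coordT Tw0 linear0 mulr0.
pose w := ((linfun LT)^-1)%VF (\sum_(i < \dim {:V}) phi e`_i *: e`_i).
have Tw : T w = \sum_(i < \dim {:V}) phi e`_i *: e`_i.
  by have := lker0_lfunVK ker0 (\sum_(i < \dim {:V}) phi e`_i *: e`_i); rewrite lfunE.
exists w => v; rewrite (coord_vbasis (memvf v)) ip_sumr linear_sum.
apply: eq_bigr => i _; rewrite ipZr linearZ /=; congr (_ * _).
by rewrite -coordT Tw coord_sum_free.
Qed.

(** If [x] were outside [U], some coordinate of [v - projv U v] would be a linear form in [v] that
    vanishes on [U] but not at [x]; the vector representing it contradicts the hypothesis. *)
Lemma orthogonal_of_orthogonal U x : nondegenerate g ->
  (forall w, (forall u, u \in U -> g w u = 0) -> g w x = 0) -> x \in U.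
Proof.
move=> gnd hx; pose y := x - projv U x.
case: (eqVneq y 0) => [/eqP|y0].
  by rewrite subr_eq0 => /eqP ->; exact: memv_proj.
pose e := vbasis {:V}; have efree : free e := basis_free (vbasisP _).
have [i ci] : exists i, coord e i y != 0.
  apply/existsP; apply: contraNT y0; rewrite negb_exists => /forallP c0.
  rewrite (coord_vbasis (memvf y)) big1 // => i _.
  by have /negbNE/eqP -> := c0 i; rewrite scale0r.
pose phi := coord e i \o (\1 - projv U)%VF.
have [w hw] := form_representable phi gnd.
have gw v : g w v = coord e i (v - projv U v).
  by rewrite hw /= add_lfunE opp_lfunE id_lfunE.
have := hx w; rewrite gw => hx0; case/eqP: ci; apply: hx0 => u uU.
by rewrite gw projv_id // subrr linear0.
Qed.

Lemma orthogonal_eq0_mem U x : nondegenerate g ->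
  (forall w, (forall u, u \in U -> g w u = 0) -> w = 0) -> x \in U.
Proof.
by move=> gnd hU; apply: orthogonal_of_orthogonal => // w /hU ->; rewrite ip0l.
Qed.

End Form.

(** * Real and complex eigenvectors of a real endomorphism *)

Section Eigen.
Variables (R : realType) (V : vectType R).
Implicit Types (f : 'End(V)) (u v w x y : V) (U W : {vspace V}) (a b c : R).

Definition shift f a : 'End(V) := f - a *: \1%VF.
(** The real polynomial with roots [a + ib] and [a - ib], evaluated at [f]. *)
Definition quad f a b : 'End(V) := (shift f a \o shift f a)%VF + b ^+ 2 *: \1%VF.

Lemma shiftE f a v : shift f a v = f v - a *: v.
Proof. by rewrite add_lfunE opp_lfunE scale_lfunE id_lfunE. Qed.

Lemma quadE f a b v : quad f a b v = shift f a (shift f a v) + b ^+ 2 *: v.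
Proof. by rewrite add_lfunE comp_lfunE scale_lfunE id_lfunE. Qed.

(** The hypotheses say that [u + iv] is an eigenvector of the complexification for [a + ib]. *)
Lemma quad_eq0 f a b u v : f u = a *: u - b *: v -> f v = b *: u + a *: v ->
  quad f a b u = 0 /\ quad f a b v = 0.
Proof.
move=> fu fv; have su : shift f a u = - b *: v.
  by rewrite shiftE fu addrAC subrr sub0r scaleNr.
have sv : shift f a v = b *: u by rewrite shiftE fv addrK.
by rewrite !quadE su sv !linearZ /= su sv !scalerA mulNr mulrN -expr2
  !scaleNr !addNr.
Qed.

Lemma shift_quad_kernel f a b v : quad f a b v = 0 ->
  shift f a (shift f a v) = - b ^+ 2 *: v.
Proof. by move=> qv; apply/eqP; rewrite scaleNr -addr_eq0 -quadE qv. Qed.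

Lemma eigenvalue_trmx (F : fieldType) n (A : 'M[F]_n) z :
  eigenvalue A^T z = eigenvalue A z.
Proof.
rewrite !eigenvalue_root_char /char_poly -[in RHS]det_tr; congr (root (\det _) _).
by rewrite /char_poly_mx linearB /= tr_scalar_mx map_trmx.
Qed.

Lemma complex_eigenvector m (e : m.-tuple V) f z : free e ->
  (forall i : 'I_m, f e`_i \in <<e>>%VS) ->
  eigenvalue (map_mx (real_complex R) (endo_mx e f)) z ->
  exists u v, [/\ u \in <<e>>%VS, v \in <<e>>%VS, (u != 0) || (v != 0),
    f u = complex.Re z *: u - complex.Im z *: v &
    f v = complex.Im z *: u + complex.Re z *: v].
Proof.
(* [eigenvalueP] yields row eigenvectors, whereas [endo_mx] acts on columns of coordinates; hence
   the transposition. *)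
move=> efree fe; rewrite -eigenvalue_trmx => /eigenvalueP[x xM x0].
set M := endo_mx e f in xM.
have ReIm (w : R[i]) : w = (complex.Re w +i* complex.Im w)%C by case: w.
have xE i : \sum_j (M i j)%:C%C * x 0 j = z * x 0 i.
  have := congr1 (fun y : 'rV_m => y 0 i) xM; rewrite !mxE => <-.
  by apply: eq_bigr => j _; rewrite !mxE mulrC.
pose p i := complex.Re (x 0 i); pose q i := complex.Im (x 0 i).
have ReS (F : 'I_m -> R[i]) : complex.Re (\sum_j F j) = \sum_j complex.Re (F j).
  by apply: (big_morph (@complex.Re R)) => // -[? ?] [? ?].
have ImS (F : 'I_m -> R[i]) : complex.Im (\sum_j F j) = \sum_j complex.Im (F j).
  by apply: (big_morph (@complex.Im R)) => // -[? ?] [? ?].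
have ReM (s : R) (w : R[i]) : complex.Re (s%:C%C * w) = s * complex.Re w.
  by case: w => wr wi /=; rewrite mul0r subr0.
have ImM (s : R) (w : R[i]) : complex.Im (s%:C%C * w) = s * complex.Im w.
  by case: w => wr wi /=; rewrite mul0r addr0.
have pE i : \sum_j M i j * p j = complex.Re z * p i - complex.Im z * q i.
  have := congr1 (@complex.Re R) (xE i); rewrite ReS.
  under eq_bigr do rewrite ReM.
  by move=> ->; rewrite /p /q; case: (z) (x 0 i) => ? ? [].
have qE i : \sum_j M i j * q j = complex.Im z * p i + complex.Re z * q i.
  have := congr1 (@complex.Im R) (xE i); rewrite ImS.
  under eq_bigr do rewrite ImM.
  by move=> ->; rewrite /p /q; case: (z) (x 0 i) => ? ? [] /= *; rewrite addrC.
have fsum (r : 'I_m -> R) :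
    f (\sum_j r j *: e`_j) = \sum_i (\sum_j M i j * r j) *: e`_i.
  rewrite linear_sum; under eq_bigr => j _.
    rewrite linearZ /= (coord_span (fe j)) scaler_sumr; over.
  rewrite exchange_big; apply: eq_bigr => i _; rewrite scaler_suml.
  by apply: eq_bigr => j _; rewrite scalerA mxE (tnth_nth 0) mulrC.
have span_sum (r : 'I_m -> R) : \sum_j r j *: e`_j \in <<e>>%VS.
  apply: memv_suml => j _; apply/memvZ/memv_span/mem_nth.
  by rewrite size_tuple.
exists (\sum_j p j *: e`_j), (\sum_j q j *: e`_j); split => //.
- apply: contraNT x0; rewrite negb_or !negbK => /andP[/eqP p0 /eqP q0].
  apply/eqP/rowP => i; rewrite mxE [LHS]ReIm -/(p i) -/(q i).
  by rewrite (freeP efree p p0 i) (freeP efree q q0 i).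
- rewrite fsum !scaler_sumr -sumrB; apply: eq_bigr => i _.
  by rewrite pE scalerBl !scalerA.
- rewrite fsum !scaler_sumr -big_split; apply: eq_bigr => i _ /=.
  by rewrite qE scalerDl !scalerA.
Qed.

(** [R[i]] is algebraically closed, so [f] restricted to [W] has a complex eigenvector; its real or
    its imaginary part is nonzero and serves as [v]. *)
Lemma invariant_vector f W : W != 0%VS -> (forall v, v \in W -> f v \in W) ->
  exists v, [/\ v \in W, v != 0 & (exists a, f v = a *: v) \/
    (exists a b, b != 0 /\ quad f a b v = 0)].
Proof.
move=> W0 fW; pose e := vbasis W.
have eW : <<e>>%VS = W := span_basis (vbasisP W).
have [|z zM] := eigenvalue_closed (map_mx (real_complex R) (endo_mx e f)).
  by rewrite lt0n dimv_eq0.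
have [||u [v [uW vW uv0 fu fv]]] := complex_eigenvector _ _ zM.
- exact: basis_free (vbasisP W).
- by move=> i; rewrite eW fW // vbasis_mem // mem_nth // size_tuple.
rewrite eW in uW vW.
have [b0|b0] := eqVneq (complex.Im z) 0; last first.
  have [qu qv] := quad_eq0 fu fv.
  have [u0|u0] := eqVneq u 0; last first.
    by exists u; split => //; right; exists (complex.Re z), (complex.Im z).
  exists v; split => //; last by right; exists (complex.Re z), (complex.Im z).
  by move: uv0; rewrite u0 eqxx.
rewrite b0 !scale0r subr0 add0r in fu fv.
have [u0|u0] := eqVneq u 0; last first.
  by exists u; split => //; left; exists (complex.Re z).
exists v; split => //; last by left; exists (complex.Re z).
by move: uv0; rewrite u0 eqxx.
Qed.

End Eigen.

(** * Causal geometry of Lorentzian spaces and symmetric endomorphisms *)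

Section Lorentz.
Variables (R : realType) (V : vectType R) (g : {symmetric V}).
Implicit Types (f : 'End(V)) (t u v w x y : V) (U W : {vspace V}) (a b c : R).

Definition positive_on W := forall w, w \in W -> w != 0 -> 0 < g w w.

(** The basis-free form in which the Lorentzian signature enters all later arguments. *)
Definition timelike_axis t :=
  g t t < 0 /\ forall w, g t w = 0 -> w != 0 -> 0 < g w w.

Lemma lorentzian_axis : lorentzian g -> exists t, timelike_axis t.
Proof.
move=> [_ [n [e [ebasis eorth neg1 posn]]]].
have dimn : \dim {:V} = n := size_basis ebasis.
rewrite dimn in posn.
have /cards1P[i0 negE] : #|[set i : 'I_n | g (tnth e i) (tnth e i) < 0]| == 1%N.
  by apply/eqP.
(* The [n - 1] positive indices avoid [i0], so they are all the other ones: no basis vector is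
   null. *)
have posE : [set i : 'I_n | 0 < g (tnth e i) (tnth e i)] = ~: [set i0].
  apply/eqP; rewrite eqEcard posn cardsC1 card_ord leqnn andbT.
  apply/subsetP => i; rewrite inE => gi; rewrite -negE !inE.
  by rewrite -leNgt ltW.
have gi0 : g (tnth e i0) (tnth e i0) < 0.
  by have := set11 i0; rewrite -negE inE.
have gpos i : i != i0 -> 0 < g (tnth e i) (tnth e i).
  move=> ii0; have : i \in ~: [set i0] by rewrite !inE.
  by rewrite -posE inE.
exists (tnth e i0); split => // w gw w0.
have wE : w = \sum_i coord e i w *: tnth e i.
  rewrite {1}(coord_basis ebasis (memvf w)); apply: eq_bigr => i _.
  by rewrite (tnth_nth 0).
have gwi i : g w (tnth e i) = coord e i w * g (tnth e i) (tnth e i).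
  rewrite ipC {1}wE ip_sumr (bigD1 i) //= big1 => [|j ji].
    by rewrite ipZr addr0.
  by rewrite ipZr eorth ?mulr0 // eq_sym.
have ci0 : coord e i0 w = 0.
  apply/eqP; move: gw; rewrite ipC gwi => /eqP.
  by rewrite mulf_eq0 [X in _ || X]lt_eqF // orbF.
have term_ge0 i : 0 <= coord e i w * (coord e i w * g (tnth e i) (tnth e i)).
  have [->|ii0] := eqVneq i i0; first by rewrite ci0 !mul0r.
  by rewrite mulrA mulr_ge0 ?sqr_ge0 -?expr2 ?sqr_ge0 // ltW ?gpos.
have gwwE : g w w = \sum_i coord e i w * (coord e i w * g (tnth e i) (tnth e i)).
  rewrite {2}wE ip_sumr; apply: eq_bigr => i _.
  by rewrite ipZr gwi.
rewrite lt_def gwwE sumr_ge0 ?andbT // psumr_eq0 //.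
apply: contraNN w0 => /allP c0; rewrite wE big1 // => i _.
have [->|ii0] := eqVneq i i0; first by rewrite ci0 scale0r.
have /eqP := c0 i (mem_index_enum i); rewrite mulrA => /eqP.
by rewrite mulf_eq0 [X in _ || X]gt_eqF ?gpos // orbF -expr2 sqrf_eq0
  => /eqP ->; rewrite scale0r.
Qed.

(* Every plane meets the positive hyperplane orthogonal to the axis. *)
Lemma timelike_axis_plane t u w (z := g t w *: u - g t u *: w) :
  timelike_axis t -> 0 <= g z z /\ (g z z = 0 -> z = 0).
Proof.
move=> [_ tpos]; have tz : g t z = 0.
  by rewrite /z !ipE mulrC subrr.
have [->|z0] := eqVneq z 0; first by rewrite ip0l.
have := tpos z tz z0 => zz; split; first exact: ltW.
by move=> zz0; rewrite zz0 ltxx in zz.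
Qed.

(** For [z = g t0 w *: t - g t0 t *: w] the cross terms vanish, so [0 <= g z z] reads [0 <= (g t0
    w)^2 * g t t + (g t0 t)^2 * g w w]. When [g t0 w <> 0] the first term is negative, which forces
    [0 < g w w]. *)
Lemma timelike_orthogonal t0 t w : timelike_axis t0 ->
  g t t < 0 -> g t w = 0 -> w != 0 -> 0 < g w w.
Proof.
move=> ax tt tw w0; have [_ pos0] := ax.
have [zz _] := timelike_axis_plane t w ax.
have [/eqP t0w|t0w] := boolP (g t0 w == 0); first exact: pos0.
have wt : g w t = 0 by rewrite ipC.
move: zz; rewrite !ipE tw wt => zz.
have t0w2 : 0 < g t0 w ^+ 2 by rewrite exprn_even_gt0.
have t0t2 : 0 <= g t0 t ^+ 2 by rewrite sqr_ge0.
rewrite ltNge; apply/negP => ww; nra.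
Qed.

(** The vector [z = g t0 w *: x - g t0 x *: w] is orthogonal to the axis and has square
    [(g t0 x)^2 * g w w], where [g t0 x <> 0] because a nonzero null vector is not orthogonal to the
    axis. *)
Lemma null_orthogonal t0 x w : timelike_axis t0 ->
  x != 0 -> g x x = 0 -> g x w = 0 ->
  0 <= g w w /\ (g w w = 0 -> w \in <[x]>%VS).
Proof.
move=> ax x0 xx xw; have [_ pos0] := ax.
have t0x : g t0 x != 0.
  by apply: contraTN x0 => /eqP t0x; apply/negP => /(pos0 x t0x); rewrite xx ltxx.
have wx : g w x = 0 by rewrite ipC.
have [zz z0] := timelike_axis_plane x w ax.
have zzE : g (g t0 w *: x - g t0 x *: w) (g t0 w *: x - g t0 x *: w) =
    g t0 x ^+ 2 * g w w by rewrite !ipE xx xw wx; ring.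
rewrite zzE in zz z0; split.
  by move: zz; rewrite pmulr_rge0 // exprn_even_gt0.
move=> ww; have /eqP : g t0 w *: x - g t0 x *: w = 0.
  by apply: z0; rewrite ww mulr0.
rewrite subr_eq0 => /eqP E; apply/vlineP; exists ((g t0 x)^-1 * g t0 w).
by rewrite -scalerA E scalerA mulVf // scale1r.
Qed.

Lemma symmetric_shift f a : symmetric_endo g f -> symmetric_endo g (shift f a).
Proof. by move=> fs u v; rewrite !shiftE !ipE fs. Qed.

Lemma ip_quad f a b v : symmetric_endo g f ->
  g (quad f a b v) v = g (shift f a v) (shift f a v) + b ^+ 2 * g v v.
Proof. by move=> fs; rewrite quadE !ipE (symmetric_shift a fs). Qed.

Lemma symmetric_quad f a b : symmetric_endo g f -> symmetric_endo g (quad f a b).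
Proof.
by move=> fs u v; rewrite !quadE !ipE !(symmetric_shift a fs).
Qed.

Lemma shift_invariant f a W : (forall v, v \in W -> f v \in W) ->
  forall v, v \in W -> shift f a v \in W.
Proof. by move=> fW v vW; rewrite shiftE memvB ?memvZ ?fW. Qed.

(** Pairing [quad f a b v] with [v] gives the square of [shift f a v] plus [b ^+ 2 * g v v], a sum
    that is positive on [W] unless [v = 0]. *)
Lemma quad_positive f a b W : symmetric_endo g f ->
  (forall v, v \in W -> f v \in W) -> positive_on W -> b != 0 ->
  forall v, v \in W -> quad f a b v = 0 -> v = 0.
Proof.
move=> fs fW Wpos b0 v vW qv; apply/eqP; apply: contraT => v0.
have := ip_quad a b v fs; rewrite qv ip0l.
have : 0 < b ^+ 2 * g v v by rewrite mulr_gt0 ?exprn_even_gt0 ?Wpos.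
have : 0 <= g (shift f a v) (shift f a v).
  have [->|s0] := eqVneq (shift f a v) 0; first by rewrite ip0l.
  by rewrite ltW // Wpos // shift_invariant.
lra.
Qed.

Lemma orthov_invariant f W : symmetric_endo g f ->
  (forall v, v \in W -> f v \in W) -> forall v, v \in orthov g W -> f v \in orthov g W.
Proof.
move=> fs fW v /mem_orthovP vW; apply/mem_orthovP => w wW.
by rewrite fs vW ?fW.
Qed.

Lemma orthov_line_invariant f x a : symmetric_endo g f -> f x = a *: x ->
  forall v, v \in orthov g <[x]> -> f v \in orthov g <[x]>.
Proof.
move=> fs fx; apply: orthov_invariant => // _ /vlineP[c ->].
by rewrite linearZ /= fx memvZ // memvZ // memv_line.
Qed.

Lemma dim_cap_orthov_line W x : x \in W -> g x x != 0 ->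
  \dim (W :&: orthov g <[x]>)%VS = (\dim W).-1.
Proof.
move=> xW xx; rewrite -eq_dim_orthov1 //.
by apply/mem_orthovPn; exists x.
Qed.

(** The spectral theorem, by induction on the dimension: positivity excludes non-real eigenvalues,
    and the orthogonal of an eigenvector inside [W] is again invariant. *)
Lemma orthonormal_eigenbasis f W : symmetric_endo g f ->
  (forall v, v \in W -> f v \in W) -> positive_on W ->
  exists s : seq V, [/\ basis_of W s,
    (forall i j, (i < size s)%N -> (j < size s)%N -> g s`_i s`_j = (i == j)%:R) &
    (forall v, v \in s -> exists a, f v = a *: v)].
Proof.
move=> fs; move dimW : (\dim W) => n.
elim: n W dimW => [|n IH] W dimW fW Wpos.
  exists [::]; split => //; move/eqP: dimW; rewrite dimv_eq0 => /eqP ->.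
  exact: nil_basis.
have W0 : W != 0%VS by rewrite -dimv_eq0 dimW.
have [v [vW v0 [[a fv]|[a [b [b0 qv]]]]]] := invariant_vector W0 fW; last first.
  by move: v0; rewrite (quad_positive fs fW Wpos b0 vW qv) eqxx.
have vv : 0 < g v v := Wpos v vW v0.
pose x := (Num.sqrt (g v v))^-1 *: v.
have xW : x \in W by rewrite memvZ.
have xx : g x x = 1.
  rewrite !ipE mulrA -expr2 exprVn sqr_sqrtr ?ltW // mulVf //.
  by rewrite gt_eqF.
have fx : f x = a *: x by rewrite linearZ /= fv !scalerA mulrC.
pose W' := (W :&: orthov g <[x]>)%VS.
have [|v' /memv_capP[v'W v'x]|v' /memv_capP[v'W _]|s [sbasis son sf]] := IH W'.
- by rewrite dim_cap_orthov_line ?xx ?oner_eq0 // dimW.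
- by apply/memv_capP; rewrite fW // (orthov_line_invariant fs fx).
- exact: Wpos.
have sx w : w \in W' -> g x w = 0.
  by move=> /memv_capP[_]; rewrite mem_orthov1 ipC => /eqP.
have ssx i : (i < size s)%N -> g x s`_i = 0.
  by move=> si; rewrite sx // (basis_mem sbasis) // mem_nth.
exists (x :: s); split.
- have sspan := span_basis sbasis.
  rewrite basisEfree free_cons (basis_free sbasis) sspan andbT; apply/and3P; split.
  + by apply: contraT => /negbNE /sx; rewrite xx => /eqP; rewrite oner_eq0.
  + by rewrite span_cons sspan subv_add capvSl andbT -memvE.
  + by rewrite dimW /= -(eqnP (basis_free sbasis)) sspan dim_cap_orthov_line
      ?xx ?oner_eq0 // dimW.
- by move=> [|i] [|j] //= si sj; [rewrite ssx | rewrite ipC ssx | rewrite son].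
- by move=> v'; rewrite inE => /predU1P[->|/sf //]; exists a.
Qed.

(* Split off spacelike eigenvectors until another kind of vector shows up. *)
Lemma causal_invariant_vector f W t : symmetric_endo g f ->
  (forall v, v \in W -> f v \in W) -> t \in W -> g t t < 0 ->
  exists2 v, v != 0 & (exists a, f v = a *: v /\ g v v <= 0) \/
    (exists a b, b != 0 /\ quad f a b v = 0).
Proof.
move=> fs; have [n] := ubnP (\dim W).
elim: n W t => // n IH W t; rewrite ltnS => dimW fW tW tt.
have t0 : t != 0 by apply: contraTneq tt => ->; rewrite ip0l ltxx.
have W0 : W != 0%VS.
  by apply: contraNneq t0 => W0; rewrite -memv0 -W0.
have [v [vW v0 [[a fv]|H]]] := invariant_vector W0 fW; last by exists v => //; right.
have [vv|vv] := leP (g v v) 0; first by exists v => //; left; exists a.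
have vv0 : g v v != 0 by rewrite gt_eqF.
(* Removing from [t] its component along the spacelike [v] does not increase its square, so the rest
   is still timelike. *)
apply: (IH (W :&: orthov g <[v]>)%VS (t - (g t v / g v v) *: v)).
- rewrite dim_cap_orthov_line //; apply: leq_trans dimW.
  by rewrite prednK // lt0n dimv_eq0.
- by move=> w /memv_capP[wW wv]; apply/memv_capP; rewrite fW //
    (orthov_line_invariant fs fv).
- rewrite memv_cap memvB ?memvZ //= mem_orthov1 !ipE.
  by rewrite divfK // subrr.
- rewrite !ipE divfK // (ipC g v t).
  have : 0 <= g t v / g v v * g t v.
    by rewrite mulrAC -expr2 divr_ge0 ?sqr_ge0 // ltW.
  lra.
Qed.

End Lorentz.

(** * Curvature tensors whose endomorphisms commute with the Ricci operator *)

Section Curvature.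
Variables (R : realType) (V : vectType R) (g : {symmetric V}).
Variables (K : {bilinear V -> V -> 'End(V)}) (Ric : 'End(V)).
Hypothesis gnd : nondegenerate g.
Hypothesis Kcurv : curvature_tensor g K.
Hypothesis Ric_def : ricci_operator g K Ric.
Implicit Types (f : 'End(V)) (t u v w x y z : V) (U W : {vspace V}) (a b c : R).

Lemma curvature_pair_symmetry u v w z : g (K u v w) z = g (K w z u) v.
Proof.
have anti p q r s : g (K p q r) s = - g (K q p r) s.
  by rewrite (curvature_anti Kcurv p q) opp_lfunE ipNl.
have skew p q r s : g (K p q r) s = - g (K p q s) r.
  by rewrite (curvature_so Kcurv) ipC.
have bianchi p q r s : g (K p q r) s + g (K q r p) s + g (K r p q) s = 0.
  by rewrite -!ipDl (curvature_bianchi Kcurv) ip0l.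
(* Four Bianchi identities, each with a different vector in the last slot; the skewness relations
   identify their terms up to sign, and pair symmetry is a linear combination. *)
have := bianchi u v w z; have := bianchi v w z u.
have := bianchi w z u v; have := bianchi z u v w.
have := skew v w z u; have := skew w z v u; have := skew u v z w.
have := skew z u v w; have := anti u w z v; have := skew w u z v.
have := anti z v w u; have := skew v z w u.
lra.
Qed.

Lemma curvature_diag u : K u u = 0.
Proof.
apply/eqP; have /eqP := curvature_anti Kcurv u u.
by rewrite -addr_eq0 -mulr2n -scaler_nat scaler_eq0 pnatr_eq0.
Qed.

Definition balanced f := forall u v, K (f u) v = K u (f v).

(** Pair symmetry gives [g (K (f u) v w) z = g (K w z (f u)) v]; there [f] commutes past [K w z],
    moves to [v] by symmetry, and pair symmetry is applied back. *)
Lemma balanced_commuting f : symmetric_endo g f ->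
  (forall u v, (K u v \o f)%VF = (f \o K u v)%VF) -> balanced f.
Proof.
move=> fs Kf u v; apply/lfunP => w; apply/eqP; rewrite -subr_eq0; apply/eqP.
apply: (nondegenerate_eq0 gnd) => z; rewrite !ipE.
rewrite !(curvature_pair_symmetry _ _ w z) -fs.
have /lfunP/(_ u) := Kf w z; rewrite !comp_lfunE => ->.
by rewrite subrr.
Qed.

Lemma balanced_diag f u : balanced f -> K (f u) u = 0.
Proof.
move=> fb; apply/eqP; have /eqP : K (f u) u = - K (f u) u.
  by rewrite {1}fb (curvature_anti Kcurv).
by rewrite -addr_eq0 -mulr2n -scaler_nat scaler_eq0 pnatr_eq0.
Qed.

Lemma balanced_shift f a : balanced f -> balanced (shift f a).
Proof.
move=> fb u v; rewrite !shiftE linearBl linearBr fb.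
by rewrite linearZl_LR linearZr_LR.
Qed.

Lemma balanced_quad f a b : balanced f -> balanced (quad f a b).
Proof.
move=> fb u v; have sb := balanced_shift a fb.
by rewrite !quadE linearDl linearDr !sb linearZl_LR linearZr_LR.
Qed.

Definition nullity x : {vspace V} := lker (linfun (K x)).

Lemma mem_nullity x v : (v \in nullity x) = (K x v == 0).
Proof. by rewrite memv_ker lfunE. Qed.

Lemma ricci_curvatureE u v : ricci_curvature K u v =
  \sum_(i < \dim {:V}) coord (vbasis {:V}) i (K u (vbasis {:V})`_i v).
Proof.
have lin : linear (fun w => K u w v).
  by move=> c x y; rewrite linearPr add_lfunE scale_lfunE.
pose F : {linear V -> V} := HB.pack (fun w => K u w v)
  (GRing.isLinear.Build _ _ _ _ (fun w => K u w v) lin).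
have E w : linfun (fun w => K u w v) w = K u w v := lfunE F w.
by apply: eq_bigr => i _; rewrite mxE (tnth_nth 0) E.
Qed.

(** With [d] the dual basis for [g], the trace is the sum of [g (d i) (d j) * g e_j (f e_i)]: a
    symmetric factor times an antisymmetric one. *)
Lemma skew_trace f : skew_endo g f ->
  \sum_(i < \dim {:V}) coord (vbasis {:V}) i (f (vbasis {:V})`_i) = 0.
Proof.
move=> fskew; set e := vbasis {:V}.
have /fin_all_exists[d hd] (i : 'I_(\dim {:V})) :
    exists w, forall v, g w v = coord e i v by exact: form_representable gnd.
set S := LHS; suff /eqP : S = - S.
  by rewrite -addr_eq0 -mulr2n mulrn_eq0 => /eqP.
have SE : S = \sum_i \sum_j g (d i) (d j) * g e`_j (f e`_i).
  apply: eq_bigr => i _; rewrite -hd ipC.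
  rewrite {1}(coord_vbasis (memvf (d i))) ip_sumr; apply: eq_bigr => j _.
  by rewrite ipZr -hd (ipC g (d j)) (ipC g (f _)).
rewrite {2}SE exchange_big SE -sumrN; apply: eq_bigr => i _ /=.
rewrite -sumrN; apply: eq_bigr => j _.
by rewrite (ipC g (d j)) -mulrN (ipC g e`_i) fskew opprK.
Qed.

(** By the Bianchi identity [K u w v - K v w u = K u v w], so the antisymmetric part of the Ricci
    curvature is the trace of the skew [K u v]. *)
Lemma ricci_symmetric : symmetric_endo g Ric.
Proof.
move=> u v; rewrite (ipC g u) !Ric_def !ricci_curvatureE.
apply/eqP; rewrite -subr_eq0 -sumrB; apply/eqP.
rewrite -[RHS](skew_trace (curvature_so Kcurv u v)).
apply: eq_bigr => i _; rewrite -linearB; congr (coord _ _ _).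
set w := (vbasis {:V})`_i.
have /eqP := curvature_bianchi Kcurv u w v.
rewrite (curvature_anti Kcurv w v) (curvature_anti Kcurv v u) !opp_lfunE.
by rewrite subr_eq0 => /eqP.
Qed.

Lemma ricci_eq0 x : (forall v, K x v = 0) -> Ric x = 0.
Proof.
move=> Kx; apply: (nondegenerate_eq0 gnd) => v.
rewrite Ric_def ricci_curvatureE big1 // => i _.
by rewrite Kx zero_lfunE linear0.
Qed.

Variable t0 : V.
Hypothesis axis : timelike_axis g t0.

Lemma quad_kernel_timelike f a b v (s := shift f a v) : symmetric_endo g f ->
  b != 0 -> v != 0 -> quad f a b v = 0 ->
  exists c1 c2, g (c1 *: v + c2 *: s) (c1 *: v + c2 *: s) < 0.
Proof.
move=> fs b0 v0 qv.
have ssE : shift f a s = - b ^+ 2 *: v := shift_quad_kernel qv.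
have b2 : 0 < b ^+ 2 by rewrite exprn_even_gt0.
have gss : g s s = - b ^+ 2 * g v v.
  by rewrite {1}/s (symmetric_shift a fs) ssE ipZr.
(* As [g s s] and [g v v] have opposite signs, [v] or [s] is timelike unless both are null. *)
have [vv|vv|vv] := ltgtP (g v v) 0.
- by exists 1, 0; rewrite scale0r addr0 scale1r.
- exists 0, 1; rewrite scale0r add0r scale1r gss.
  by rewrite mulNr oppr_lt0 mulr_gt0.
have [vs|vs] := eqVneq (g v s) 0; last first.
  (* The square of this vector is [- 2 * (g v s)^2]. *)
  exists (- g v s), 1; rewrite scale1r !ipE gss vv (ipC g s v).
  have : 0 < g v s ^+ 2 by rewrite exprn_even_gt0.
  lra.
(* Orthogonal null vectors are proportional, so [s = c *: v]; then [c ^+ 2 = - b ^+ 2], which is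
   absurd. *)
have [_ /(_ _)/vlineP] := null_orthogonal axis v0 vv vs.
rewrite gss vv mulr0 => /(_ erefl)[c sE].
have : c ^+ 2 + b ^+ 2 != 0 by rewrite gt_eqF // ltr_wpDl ?sqr_ge0.
move/negP; case; move/eqP: ssE; rewrite sE linearZ /= -/s sE scalerA -subr_eq0.
by rewrite -scalerBl scaler_eq0 (negPf v0) orbF opprK.
Qed.

Lemma nullity_quad_kernel f a b v : symmetric_endo g f -> balanced f ->
  b != 0 -> v != 0 -> quad f a b v = 0 -> forall w, K v w = 0.
Proof.
move=> fs fb b0 v0 qv w; apply/eqP; rewrite -mem_nullity.
apply: (orthogonal_eq0_mem _ gnd) => {}w wZ.
set s := shift f a v.
have ssE : shift f a s = - b ^+ 2 *: v := shift_quad_kernel qv.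
have [c1 [c2 tt]] := quad_kernel_timelike fs b0 v0 qv.
pose P := (<[v]> + <[s]>)%VS.
have inP c c' : c *: v + c' *: s \in P.
  by apply: memv_add; rewrite memvZ // memv_line.
have vP : v \in P by rewrite (subvP (addvSl _ _)) ?memv_line.
have sP : s \in P by rewrite (subvP (addvSr _ _)) ?memv_line.
have fP p : p \in P -> f p \in P.
  have fvP : f v \in P by rewrite -[f v](subrK (a *: v)) -shiftE memvD ?memvZ.
  have fsP : f s \in P.
    by rewrite -[f s](subrK (a *: s)) -shiftE ssE memvD ?memvZ.
  move=> /memv_addP[_ /vlineP[c ->] [_ /vlineP[c' ->] ->]].
  by rewrite linearD !linearZ memvD ?memvZ.
have Zgen p : K v p = 0 -> g w p = 0.
  by move=> vp; apply: wZ; rewrite mem_nullity vp.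
have qb := balanced_quad a b fb.
(* [quad f a b] is injective on the orthogonal of [P], which is positive definite since [P] contains
   a timelike vector. It remains that [w] lies there, because [K v] kills [v] and [s], and that
   [quad f a b w = 0], because [K v] kills the image of [quad f a b]. *)
apply: (quad_positive (a := a) fs (orthov_invariant fs fP) _ b0).
- move=> p /mem_orthovP pP p0; apply: (timelike_orthogonal axis tt) => //.
  by rewrite ipC; exact: pP.
- apply/mem_orthovP => _ /memv_addP[_ /vlineP[c ->] [_ /vlineP[c' ->] ->]].
  rewrite ipDr !ipZr !Zgen ?curvature_diag ?mulr0 ?addr0 //.
  by rewrite (curvature_anti Kcurv) (balanced_diag _ (balanced_shift a fb)) oppr0.
- apply: (nondegenerate_eq0 gnd) => p.
  by rewrite symmetric_quad // Zgen // -qb qv linear0l.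
Qed.

(** * Null eigenvectors orthogonal to their whole eigenspace *)

Section NullEigenvector.
Variables (x : V) (a : R).
Hypotheses (Ricb : balanced Ric) (x0 : x != 0) (xx : g x x = 0).
Hypothesis Rx : Ric x = a *: x.
Let N := shift Ric a.
Hypothesis kerN : forall k, N k = 0 -> g x k = 0.

Let Ns : symmetric_endo g N := symmetric_shift a ricci_symmetric.
Let Nb : balanced N := balanced_shift a Ricb.
Let Nx : N x = 0.
Proof. by rewrite /N shiftE Rx subrr. Qed.

(** Such a [w] is orthogonal to itself and, by [kerN], to the null vector [x]. *)
Let ker_orth_ker w : N w = 0 -> (forall k, N k = 0 -> g w k = 0) -> w \in <[x]>%VS.
Proof.
move=> Nw wk; have [_] := null_orthogonal axis x0 xx (kerN Nw).
by apply; exact: wk.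
Qed.

Let orth_img w : (forall v, g w (N v) = 0) -> N w = 0.
Proof.
by move=> wN; apply: (nondegenerate_eq0 gnd) => v; rewrite Ns wN.
Qed.

(** The orthogonal of [limg N + lker N] lies in the line of [x], so a single further vector [z] not
    orthogonal to [x] makes the nullity of [u] everything. *)
Let nullity_full u z : g x z != 0 -> K u z = 0 -> (forall v, K u (N v) = 0) ->
  (forall k, N k = 0 -> K u k = 0) -> forall v, K u v = 0.
Proof.
move=> xz uz uN uk v; apply/eqP; rewrite -mem_nullity.
apply: (orthogonal_eq0_mem _ gnd) => w wZ.
have Nw : N w = 0.
  by apply: orth_img => v'; apply: wZ; rewrite mem_nullity uN.
have /vlineP[c wE] : w \in <[x]>%VS.
  by apply: ker_orth_ker => // k Nk; apply: wZ; rewrite mem_nullity uk.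
have /eqP : g w z = 0 by apply: wZ; rewrite mem_nullity uz.
by rewrite wE ipZl mulf_eq0 (negPf xz) orbF => /eqP ->; rewrite scale0r.
Qed.

Lemma ricci_null_eigenvector : Ric x = 0 /\ exists y, Ric y = x /\ g x y != 0.
Proof.
have a_eq0 : Ric x = 0 -> a = 0.
  by rewrite Rx => /eqP; rewrite scaler_eq0 (negPf x0) orbF => /eqP.
have NE v : a = 0 -> N v = Ric v by move=> a0; rewrite /N shiftE a0 scale0r subr0.
have KxN v : K x (N v) = 0 by rewrite -Nb Nx linear0l.
(* The orthogonal of the image of [N] is contained in its kernel, hence is orthogonal to [x]. *)
have [y Ny] : exists y, N y = x.
  have /memv_imgP[y _ ->] : x \in limg N; last by exists y.
  apply: (orthogonal_of_orthogonal gnd) => w wN; rewrite ipC; apply: kerN.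
  by apply: orth_img => v; apply: wN; rewrite memv_img ?memvf.
have Kxk k : N k = 0 -> K x k = 0 by move=> Nk; rewrite -Ny Nb Nk linear0r.
have [xy|xy] := eqVneq (g x y) 0; last first.
  have Rx0 : Ric x = 0.
    by apply: ricci_eq0; apply: (nullity_full xy) => //; rewrite -Ny balanced_diag.
  by split => //; exists y; rewrite -NE ?a_eq0.
(* Otherwise x = N (N z), and N z is forced into the kernel of Ric. *)
have /memv_addP[_ /memv_imgP[z _ ->] [k]] : y \in (limg N + lker N)%VS.
  apply: (orthogonal_of_orthogonal gnd) => w wZ.
  have Nw : N w = 0.
    by apply: orth_img => v; apply: wZ; rewrite (subvP (addvSl _ _)) ?memv_img ?memvf.
  have /vlineP[c ->] : w \in <[x]>%VS.
    apply: ker_orth_ker => // k Nk; apply: wZ.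
    by rewrite (subvP (addvSr _ _)) // memv_ker Nk.
  by rewrite ipZl xy mulr0.
rewrite memv_ker => /eqP Nk yE.
have NNz : N (N z) = x by rewrite -Ny yE linearD /= Nk addr0.
(* Otherwise [g (N z) (N z) = g x z = 0], so [N z] is null and orthogonal to [x], hence a multiple
   of [x], and [x = N (N z) = 0]. *)
have xz : g x z != 0.
  rewrite -NNz Ns; apply/eqP => zz.
  have xNz : g x (N z) = 0 by rewrite -Ns Nx ip0l.
  have [_ /(_ zz)/vlineP[c Nz]] := null_orthogonal axis x0 xx xNz.
  by move: x0; rewrite -NNz Nz linearZ /= Nx scaler0 eqxx.
have Kx : forall v, K x v = 0.
  by apply: (nullity_full xz) => //; rewrite -NNz Nb curvature_diag.
have Rx0 := ricci_eq0 Kx; have a0 := a_eq0 Rx0.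
(* [K (N z)] kills [z], the image of [N] since [K (N z) (N v) = K x v = 0], and the kernel of
   [N]. *)
have RNz : Ric (N z) = 0.
  apply: ricci_eq0; apply: (nullity_full xz).
  - exact: balanced_diag.
  - by move=> v; rewrite -Nb NNz Kx.
  - by move=> k' Nk'; rewrite Nb Nk' linear0r.
by move: x0; rewrite -NNz NE // RNz eqxx.
Qed.

End NullEigenvector.

End Curvature.

(** * Adapted bases: completing a small invariant block by an orthonormal eigenbasis *)

Section NormalForms.
Variables (R : realType) (V : vectType R) (g : {symmetric V}).
Hypothesis gnd : nondegenerate g.
Implicit Types (f : 'End(V)) (t u v w x y z : V) (U W P : {vspace V}).

Lemma endo_mx_unique n (e : n.-tuple V) f (M : 'M_n) : free e ->
  (forall j, f (tnth e j) = \sum_i M i j *: tnth e i) -> endo_mx e f = M.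
Proof.
move=> efree fe; apply/matrixP => i j; rewrite mxE fe.
under eq_bigr do rewrite (tnth_nth 0).
by rewrite (coord_sum_free (fun i => M i j)).
Qed.

Lemma endo_mx_span n (e : n.-tuple V) f j : f (tnth e j) \in <<e>>%VS ->
  f (tnth e j) = \sum_i endo_mx e f i j *: tnth e i.
Proof.
move=> fe; rewrite {1}(coord_span fe); apply: eq_bigr => i _.
by rewrite mxE (tnth_nth 0 e i).
Qed.

Lemma orthov_complement P : positive_on g (orthov g P) ->
  (orthov g P :&: P = 0)%VS /\ (orthov g P + P = fullv)%VS.
Proof.
move=> Ppos.
have disj w : w \in orthov g P -> w \in P -> w = 0.
  move=> wP' wP; apply/eqP; apply: contraT => w0.
  by have := Ppos w wP' w0; move/mem_orthovP: wP' => ->; rewrite ?ltxx.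
split.
  by apply/eqP; rewrite -subv0; apply/subvP => w /memv_capP[? ?];
    rewrite memv0; apply/eqP/disj.
apply/eqP; rewrite eqEsubv subvf; apply/subvP => v _.
apply: (orthogonal_eq0_mem _ gnd) => w wU; apply: disj.
  by apply/mem_orthovP => p pP; rewrite wU // (subvP (addvSr _ _)).
(* [w] is orthogonal to [orthov g P], hence in [P] by the double orthogonal; being orthogonal to [P]
   too, it vanishes. *)
apply: (orthogonal_of_orthogonal gnd) => p pP; rewrite ipC wU //.
by rewrite (subvP (addvSl _ _)) //; apply/mem_orthovP.
Qed.

(** The orthogonal of [P] is invariant, positive definite and complementary to [P]; its orthonormal
    eigenbasis is placed before [t]. *)
Lemma normal_form_extension f k (t : k.-tuple V) P : symmetric_endo g f ->
  basis_of P t -> (forall v, v \in P -> f v \in P) ->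
  positive_on g (orthov g P) ->
  exists m (e : (m + k).-tuple V) (a : 'rV[R]_m), [/\ basis_of fullv e,
    endo_mx e f = block_mx (diag_mx a) 0 0 (endo_mx t f) &
    gram_mx g e = block_mx 1%:M 0 0 (gram_mx g t)].
Proof.
move=> fs tbasis fP Ppos.
have [s [sbasis son sf]] := orthonormal_eigenbasis fs (orthov_invariant fs fP) Ppos.
have [disj full] := orthov_complement Ppos.
pose s' := in_tuple s.
have ebasis : basis_of fullv (cat_tuple s' t).
  by rewrite -full cat_basis //; exact/directv_addP.
have efree := basis_free ebasis.
pose a : 'rV[R]_(size s) := \row_i coord s' i (f (tnth s' i)).
have fsE i : f (tnth s' i) = a 0 i *: tnth s' i.
  have [c fi] := sf _ (mem_tnth i s'); rewrite mxE fi linearZ /= {2}(tnth_nth 0).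
  by rewrite coord_free ?eqxx ?mulr1 // (basis_free sbasis).
have st i j : g (tnth s' i) (tnth t j) = 0.
  have /mem_orthovP : tnth s' i \in orthov g P by apply: (basis_mem sbasis); exact: mem_tnth.
  by apply; apply: (basis_mem tbasis); exact: mem_tnth.
exists (size s), (cat_tuple s' t), a; split => //.
- apply: endo_mx_unique => // j; rewrite big_split_ord /=.
  rewrite -[j]splitK; case: (split j) => {}j /=.
  + rewrite tnth_lshift fsE [X in _ + X]big1 => [|i _]; last first.
      by rewrite block_mxEdl mxE scale0r.
    rewrite addr0 (bigD1 j) //= big1 => [|i ij].
      by rewrite block_mxEul tnth_lshift !mxE eqxx addr0.
    by rewrite block_mxEul !mxE (negPf ij) scale0r.
  + rewrite tnth_rshift big1 => [|i _]; last by rewrite block_mxEur mxE scale0r.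
    rewrite add0r endo_mx_span.
      by apply: eq_bigr => i _; rewrite block_mxEdr tnth_rshift.
    rewrite (span_basis tbasis) fP // (basis_mem tbasis) //; exact: mem_tnth.
- apply/matrixP => l j; rewrite -[l]splitK -[j]splitK.
  case: (split l) => {}l; case: (split j) => {}j /=; rewrite mxE ?tnth_lshift ?tnth_rshift.
  + by rewrite block_mxEul mxE !(tnth_nth 0) son.
  + by rewrite block_mxEur mxE st.
  + by rewrite block_mxEdl mxE ipC st.
  + by rewrite block_mxEdr mxE.
Qed.

Variable t0 : V.
Hypothesis axis : timelike_axis g t0.

Lemma type_diag_timelike f x a : symmetric_endo g f -> f x = a *: x -> g x x < 0 ->
  type_diag g f.
Proof.
move=> fs fx xx; split => //.
have xx0 : g x x != 0 by rewrite lt_eqF.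
pose y := (Num.sqrt (- g x x))^-1 *: x.
have fy : f y = a *: y by rewrite linearZ /= fx !scalerA mulrC.
have yy : g y y = - 1.
  rewrite !ipE mulrA -expr2 exprVn sqr_sqrtr ?oppr_ge0 1?ltW //.
  by rewrite invrN mulNr mulVf.
have y0 : y != 0.
  by apply: contra_eqN yy => /eqP ->; rewrite ip0l eq_sym oppr_eq0 oner_eq0.
have [|||m [e [b [ebasis eendo egram]]]] :=
    @normal_form_extension f 1 [tuple y] <[y]>%VS fs.
- exact: seq1_basis.
- by move=> _ /vlineP[c ->]; rewrite linearZ /= fy 2?memvZ ?memv_line.
- move=> w; rewrite mem_orthov1 ipC => /eqP yw.
  by apply: (timelike_orthogonal axis _ yw); rewrite yy ltrN10.
(* The eigenvalue of the timelike vector is the last diagonal entry. *)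
exists m, e, (row_mx b (const_mx a)); split => //.
- rewrite eendo diag_mx_row; congr block_mx.
  apply: endo_mx_unique => [|j]; first by rewrite seq1_free.
  by rewrite big_ord1 !ord1 !mxE fy.
- rewrite egram; congr block_mx; apply/matrixP => i j.
  by rewrite !ord1 !mxE.
Qed.

Lemma type_n02_null f x y : symmetric_endo g f -> g x x = 0 -> f x = 0 ->
  f y = x -> g x y != 0 -> type_n02 g f.
Proof.
move=> fs xx fx fy xy; split => //.
(* Rescaling both vectors by [r] keeps the relation [f y = x] but also the sign of [g x y]; flipping
   [x] by [eps] makes the product 1 and leaves [eps] in the matrix of [f]. *)
pose eps : R := if 0 < g x y then 1 else - 1.
have eps1 : eps = 1 \/ eps = - 1 by rewrite /eps; case: ifP; [left|right].
have eps2 : eps * eps = 1 by case: eps1 => ->; rewrite ?mulrNN mulr1.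
have epsxy : eps * g x y = `|g x y|.
  rewrite /eps; case: ltP => xy0; first by rewrite mul1r gtr0_norm.
  by rewrite mulN1r ler0_norm.
pose r := (Num.sqrt `|g x y|)^-1.
have r2 : r * r * (eps * g x y) = 1.
  rewrite epsxy -expr2 exprVn sqr_sqrtr ?normr_ge0 // mulVf //.
  by rewrite normr_eq0.
pose x' := (eps * r) *: x.
(* The multiple of [x] makes [y'] null, and [f] does not see it since [f x = 0]. *)
pose y' := r *: (y - (g y y / (2 * g x y)) *: x).
have xx' : g x' x' = 0 by rewrite !ipE xx !mulr0.
have xy' : g x' y' = 1 by rewrite !ipE xx mulr0 subr0 -r2; ring.
have yy' : g y' y' = 0 by rewrite !ipE xx (ipC g y x); field.
have fx' : f x' = 0 by rewrite linearZ /= fx scaler0.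
have fy' : f y' = eps *: x'.
  by rewrite linearZ /= linearB linearZ /= fx fy scaler0 subr0 scalerA mulrA eps2 mul1r.
clearbody x' y'.
have tfree : free [:: x'; y'].
  apply/(@freeP _ _ 2 [tuple x'; y']) => k; rewrite !big_ord_recl big_ord0 addr0 /=.
  move=> kE i.
  have := congr1 (g x') kE; have := congr1 (g y') kE.
  rewrite !ipDr !ipZr xx' yy' (ipC g y') xy' !ip0r !mulr0 !mulr1 addr0 add0r.
  move=> k0 k1; case: (unliftP ord0 i) => [j|] -> //.
  by rewrite (ord1 j).
pose P := <<[:: x'; y']>>%VS.
have PE v : v \in P -> exists c d, v = c *: x' + d *: y'.
  rewrite /P span_cons span_seq1 => /memv_addP[_ /vlineP[c ->] [_ /vlineP[d ->] ->]].
  by exists c, d.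
have x'P : x' \in P by rewrite memv_span // inE eqxx.
have y'P : y' \in P by rewrite memv_span // !inE eqxx orbT.
have [|||m [e [b [ebasis eendo egram]]]] :=
    @normal_form_extension f 2 [tuple x'; y'] P fs.
- by rewrite /basis_of eqxx.
- by move=> _ /PE[c [d ->]]; rewrite linearD !linearZ /= fx' fy' scaler0 add0r !memvZ.
(* [x' - y'] has square -2, so the plane [P] contains a timelike vector. *)
- move=> w /mem_orthovP wP; apply: (timelike_orthogonal axis (t := x' - y')).
    by rewrite !ipE xx' yy' (ipC g y') xy'; lra.
  by rewrite !ipE !(ipC g _ w) !wP // subrr.
exists m, e, b, eps; split => //.
- rewrite eendo; congr block_mx.
  apply: endo_mx_unique => // j; rewrite !big_ord_recl big_ord0 addr0 !mxE.
  case: (unliftP ord0 j) => [k|] ->; rewrite ?(ord1 k) /= !(tnth_nth 0) /=.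
    by rewrite fy' mulr1 mulr0 scale0r addr0.
  by rewrite fx' !mulr0 !scale0r addr0.
- rewrite egram; congr block_mx; apply/matrixP => i j; rewrite !mxE.
  case: (unliftP ord0 i) => [k|] ->; case: (unliftP ord0 j) => [l|] ->;
    rewrite ?(ord1 k) ?(ord1 l) !(tnth_nth 0) /=.
  + by rewrite yy' addr0.
  + by rewrite ipC xy' add0r.
  + by rewrite xy' addr0.
  + by rewrite xx' addr0.
Qed.

End NormalForms.

(** * Classification of the Ricci operator through a causal eigenvector *)

Theorem proposition2p5 (R : realType) (V : vectType R) (g : {symmetric V})
    (K : {bilinear V -> V -> 'End(V)}) (Ric : 'End(V))
    (dimV : (3 <= \dim (fullv : {vspace V}))%N)
    (g_lorentzian : lorentzian g)
    (K_curvature : curvature_tensor g K)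
    (Ric_def : ricci_operator g K Ric)
    (K_Ric : forall u v : V, (K u v \o Ric)%VF = (Ric \o K u v)%VF) :
  (type_diag g Ric \/ type_n02 g Ric) /\
  (forall z : R[i], complex_eigenvalue Ric z -> complex.Im z = 0).
Proof.
have gnd : nondegenerate g := g_lorentzian.1.
have [t0 axis] := lorentzian_axis g_lorentzian.
have Rs : symmetric_endo g Ric := ricci_symmetric gnd K_curvature Ric_def.
have Rb : balanced K Ric := balanced_commuting gnd K_curvature Rs K_Ric.
(* Such a nonzero [v] would have [Ric v = 0], so [quad Ric a b] would act on it as the nonzero
   scalar [a ^+ 2 + b ^+ 2]. *)
have real_roots a b v : b != 0 -> quad Ric a b v = 0 -> v = 0.
  move=> b0 qv; apply/eqP; apply: contraT => v0.
  have Rv := ricci_eq0 gnd Ric_def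
    (nullity_quad_kernel gnd K_curvature axis Rs Rb b0 v0 qv).
  have : (a ^+ 2 + b ^+ 2) *: v = 0.
    rewrite -qv quadE !shiftE Rv !sub0r linearN linearZ /= Rv scaler0.
    by rewrite oppr0 sub0r scalerN opprK scalerA -expr2 scalerDl.
  move/eqP; rewrite scaler_eq0 (negPf v0) orbF gt_eqF //.
  by rewrite ltr_wpDl ?sqr_ge0 // exprn_even_gt0.
split; last first.
  move=> z zR; apply/eqP; apply: contraT => z0.
  have [||u [v [_ _ uv0 Ru Rv]]] := complex_eigenvector _ _ zR.
  - exact: basis_free (vbasisP _).
  - by move=> i; rewrite (span_basis (vbasisP _)) memvf.
  have [qu qv] := quad_eq0 Ru Rv.
  by move: uv0; rewrite (real_roots _ _ _ z0 qu) (real_roots _ _ _ z0 qv) eqxx.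
have [x x0 [[a [Rx xx_le0]]|[a [b [b0 qv]]]]] := causal_invariant_vector Rs
    (fun v _ => memvf (Ric v)) (memvf t0) axis.1; last first.
  by move: x0; rewrite (real_roots _ _ _ b0 qv) eqxx.
have [xx|xx] := eqVneq (g x x) 0; last first.
  by left; apply: (type_diag_timelike gnd axis Rs Rx); rewrite lt_neqAle xx.
have [kerx|/subvPn[k]] := boolP (lker (shift Ric a) <= orthov g <[x]>)%VS; last first.
  rewrite memv_ker shiftE subr_eq0 => /eqP Rk; rewrite mem_orthov1 => kx.
  (* Solves [2 * c * g k x + g k k = - 1], so that [c *: x + k] is a timelike eigenvector for
     [a]. *)
  pose c := - (g k k + 1) / (2 * g k x).
  left; apply: (type_diag_timelike gnd axis (x := c *: x + k) (a := a) Rs).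
    by rewrite linearD linearZ /= Rx Rk scalerDr !scalerA mulrC.
  have -> : g (c *: x + k) (c *: x + k) = - 1.
    by rewrite !ipE xx (ipC g x k) /c; field.
  exact: ltrN10.
right; have [|Rx0 [y [Ry xy]]] := ricci_null_eigenvector gnd K_curvature Ric_def
    axis Rb x0 xx Rx.
  move=> k kN; apply/eqP; rewrite ipC -mem_orthov1.
  by apply: (subvP kerx); rewrite memv_ker kN.
exact: (type_n02_null gnd axis Rs xx Rx0 Ry xy).
Qed.
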